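(* Let $m\ge1$, $f_1,\ldots,f_{m+1}$ arithmetic functions, and $\gamma_0,\gamma_1,\ldots,\gamma_m\in\mathbb{N}$ with $\gamma_0\mid\gamma_1\mid\cdots\mid\gamma_m$. Define $(a_{\gamma_0}S)(n_1,\ldots,n_{m+1}):=a_{\gamma_0}(n_1)\,S^{(\gamma_1,\ldots,\gamma_m)}_{f_1,\ldots,f_{m+1}}(n_1,\ldots,n_{m+1})$. Then for all $\boldsymbol s=(s_1,\ldots,s_{m+1})\in\mathbb{C}^{m+1}$ with $\Re(s_j)>1$ for $2\le j\le m+1$ and $\Re(s_1+\cdots+s_j)>\sigma(f_j)$ for $1\le j\le m+1$, \[ L(\boldsymbol s;a_{\gamma_0}S)=\prod_{j=2}^{m+1}\zeta(s_j)\cdot\prod_{j=1}^{m+1}L\bigl(s_1+\cdots+s_j;f_j^{[\gamma_{j-1}]}\bigr). \] In particular, for $\gamma_0=1$, \[ L\bigl(\boldsymbol s;S^{(\gamma_1,\ldots,\gamma_m)}_{f_1,\ldots,f_{m+1}}\bigr)=\prod_{j=2}^{m+1}\zeta(s_j)\cdot L(s_1;f_1)\prod_{j=2}^{m+1}L\bigl(s_1+\cdots+s_j;f_j^{[\gamma_{j-1}]}\bigr). \]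
   Context: An arithmetic function is a map $f:\mathbb{N}\to\mathbb{C}$, with $f(x)=0$ for $x\notin\mathbb{N}$. For $\gamma\in\mathbb{N}$, $a_\gamma(n)=1$ if $n=d^\gamma$ for some $d\in\mathbb{N}$ and $0$ otherwise; $f^{[\gamma]}:=a_\gamma f$ (pointwise product). $L(s;f)=\sum_{n\ge1}f(n)n^{-s}$, $\sigma(f)$ its abscissa of absolute convergence, $\zeta$ the Riemann zeta function. For $F:\mathbb{N}^k\to\mathbb{C}$, $L(\boldsymbol s;F):=\sum_{n_1,\ldots,n_k\ge1}F(n_1,\ldots,n_k)n_1^{-s_1}\cdots n_k^{-s_k}$. The multiple Ramanujan sum is \[ S^{(\gamma_1,\ldots,\gamma_m)}_{f_1,\ldots,f_{m+1}}(n_1,\ldots,n_{m+1}):=\sum_{\substack{(d_1,\ldots,d_m)\in\mathbb{N}^m\\ d_j^{\gamma_j}\mid\gcd(n_1,\ldots,n_{j+1})\ (1\le j\le m)}} f_1\Bigl(\frac{n_1}{d_1^{\gamma_1}}\Bigr)f_2\Bigl(\frac{d_1^{\gamma_1}}{d_2^{\gamma_2}}\Bigr)\cdots f_m\Bigl(\frac{d_{m-1}^{\gamma_{m-1}}}{d_m^{\gamma_m}}\Bigr)f_{m+1}\bigl(d_m^{\gamma_m}\bigr). \] *)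

(* Defs.v *)
From HB Require Import structures.
From mathcomp Require Import all_boot all_order all_algebra.
From mathcomp Require Import finmap.
From mathcomp Require Import all_classical all_reals all_analysis.
From mathcomp Require Import complex.

Set Implicit Arguments.
Unset Strict Implicit.
Unset Printing Implicit Defensive.

Import Order.TTheory GRing.Theory Num.Theory.
Local Open Scope ring_scope.

Section Defs.
Variable R : realType.
Local Notation C := R[i].

(* complex power  n^{-s} = e^{-s log n}  for n >= 1 *)
Definition npowN (n : nat) (s : C) : C :=
  let a : R := expR (- complex.Re s * ln (n%:R : R)) in
  let c : R := cos (complex.Im s * ln (n%:R : R)) in
  let b : R := sin (complex.Im s * ln (n%:R : R)) in
  (a%:C)%C * ((c%:C)%C - 'i%C * (b%:C)%C).

Definition abs_summable (I : choiceType) (F : I -> C) : Prop :=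
  exists M : R, forall A : {fset I}, \sum_(i <- A) `|F i| <= (M%:C)%C.

Definition has_sum (I : choiceType) (F : I -> C) (S : C) : Prop :=
  forall e : R, 0 < e -> exists A0 : {fset I},
    forall A : {fset I}, fsubset A0 A -> `|\sum_(i <- A) F i - S| < (e%:C)%C.

Definition csum (I : choiceType) (F : I -> C) : C :=
  match pselect (exists S, has_sum F S) with
  | left h => projT1 (cid h)
  | right _ => 0
  end.

(* an arithmetic function; only its values on positive integers are used *)
Definition arith := nat -> C.

Definition dterm (f : arith) (s : C) (n : nat) : C :=
  if n is 0 then 0 else f n * npowN n s.

Definition Lser (f : arith) (s : C) : C := csum (dterm f s).

Definition zeta (s : C) : C := Lser (fun _ => 1) s.

Definition abscissa (f : arith) : \bar R :=
  ereal_inf [set (x%:E)%E | x in [set x : R | abs_summable (dterm f (x%:C)%C)]].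

(* a_gamma(n) = 1 if n = d^gamma for some d, 0 otherwise
   (a witness d is necessarily <= n when n = d^gamma, gamma >= 1 or not) *)
Definition is_pow (g n : nat) : bool := [exists d : 'I_n.+1, ((d : nat) ^ g == n)%N].
Definition agam (g n : nat) : C := (is_pow g n)%:R.

Definition restr (g : nat) (f : arith) : arith := fun n => agam g n * f n.

Definition fdiv (f : arith) (a b : nat) : C :=
  if [&& (0 < a)%N, (0 < b)%N & (b %| a)%N] then f (a %/ b)%N else 0.

(* Multiple Ramanujan sum S^{(g 1,...,g m)}_{f 1,...,f (m+1)}(n 1,...,n (m+1)).
   Everything is 1-based as in the paper; d = (d_1,...,d_m) is encoded by the
   tuple t with d_k = nth 0 t (k-1).  Since d_j >= 1 and d_j^{g j} | n_1,
   every d_j satisfies d_j <= n_1 when n_1 >= 1 and g j >= 1, so the sum over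
   d_j in {0,...,n_1} (with the condition d_j >= 1) is the full sum. When
   n_1 = 0 (not in N) every term vanishes since f_1(0/..) = 0 by convention. *)
Definition ramS (m : nat) (g : nat -> nat) (f : nat -> arith) (n : nat -> nat) : C :=
  \sum_(t : m.-tuple 'I_(n 1).+1 |
         [forall j : 'I_m,
            let dj := nth 0%N (map val t) j in
            (0 < dj)%N && (dj ^ g j.+1 %| \big[gcdn/0%N]_(1 <= i < j.+3) n i)%N])
    let D := fun k : nat => if k is k'.+1 then (nth 0%N (map val t) k' ^ g k)%N
                            else n 1 in
    (\prod_(1 <= k < m.+1) fdiv (f k) (D k.-1) (D k)) * f m.+1 (D m).

Definition mterm (k : nat) (F : {ffun 'I_k -> nat} -> C) (s : 'I_k -> C)
  (x : {ffun 'I_k -> nat}) : C :=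
  if [forall i, (0 < x i)%N] then F x * \prod_i npowN (x i) (s i) else 0.

End Defs.

(* Main.v *)
(* Write D_0 = n_1, D_j = d_j^gamma_j and D_(m+1) = 1.  A term of the Ramanujan
   sum vanishes unless D_(m+1) | D_m | ... | D_0, and on such chains the
   divisibility conditions reduce to D_(j-1) | n_j.  Setting k_j = D_(j-1) / D_j
   and e_j = n_j / D_(j-1) (so e_1 = 1) gives n_j = e_j k_j k_(j+1) ... k_(m+1),
   hence the term becomes the product of the f_j(k_j) k_j^-(s_1 + ... + s_j) and
   of the e_j^-s_j.  Since gamma_0 | gamma_1 | ... | gamma_m, each D_j is a
   gamma_j-th power for 0 <= j <= m iff each k_j is a gamma_(j-1)-th power, so the
   k_j and e_j range independently and the absolutely convergent sum factors. *)
Require Import Defs.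
From HB Require Import structures.
From mathcomp Require Import all_boot all_order all_algebra.
From mathcomp Require Import finmap.
From mathcomp Require Import all_classical all_reals all_analysis.
From mathcomp Require Import complex.
From mathcomp Require Import ring lra.

Import Order.TTheory GRing.Theory Num.Theory.
Local Open Scope ring_scope.

(** * Unordered sums of complex families *)

Lemma ler_sum_fset (R : numDomainType) (I : choiceType) (A B : {fset I}) (a : I -> R) :
  fsubset A B -> (forall i, 0 <= a i) -> \sum_(i <- A) a i <= \sum_(i <- B) a i.
Proof.
move=> /fsubsetP sAB a0; rewrite (big_fsetID _ (mem A) B) /=.
rewrite [X in _ <= X + _](_ : _ = \sum_(i <- A) a i); last first.
  congr bigop; congr enum_fset; apply/fsetP => i; rewrite !inE /=.
  by rewrite andb_idl // => /sAB.
by rewrite lerDl sumr_ge0.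
Qed.

Section ComplexSums.
Variable R : realType.
Local Notation C := R[i].

Lemma normc_eqR (z : C) : exists2 r : R, 0 <= r & `|z| = (r%:C)%C.
Proof.
exists (complex.Re `|z|); last by rewrite RRe_real ?normr_real.
by rewrite -ler0c RRe_real ?normr_real.
Qed.

Lemma halvesC (e : R) : ((e / 2)%:C + (e / 2)%:C = e%:C)%C.
Proof. by rewrite -rmorphD -splitr. Qed.

Section Family.
Variable I : choiceType.
Implicit Types (F G : I -> C) (S T : C).

Lemma has_sum_unique F S T : has_sum F S -> has_sum F T -> S = T.
Proof.
move=> hS hT; apply/eqP; rewrite -subr_eq0 -normr_eq0.
have [r r0 rE] := normc_eqR (S - T); rewrite rE.
have [->//|rN0] := eqVneq r 0.
have e0 : 0 < r / 2 by rewrite divr_gt0 // lt0r rN0.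
have [A hA] := hS _ e0; have [B hB] := hT _ e0.
have := ltrD (hA _ (fsubsetUl A B)) (hB _ (fsubsetUr A B)).
rewrite halvesC -rE distrC => h.
have := ler_normD (S - \sum_(i <- (A `|` B)%fset) F i) (\sum_(i <- (A `|` B)%fset) F i - T).
by rewrite addrA subrK => /le_lt_trans /(_ h); rewrite ltxx.
Qed.

Lemma has_sumD F G S T :
  has_sum F S -> has_sum G T -> has_sum (fun i => F i + G i) (S + T).
Proof.
move=> hS hT e e0.
have [A hA] := hS _ (divr_gt0 e0 (ltr0Sn _ 1)); have [B hB] := hT _ (divr_gt0 e0 (ltr0Sn _ 1)).
exists (A `|` B)%fset => D; rewrite fsubUset => /andP[/hA AD /hB BD].
rewrite big_split opprD addrACA (le_lt_trans (ler_normD _ _)) //.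
by rewrite -halvesC ltrD.
Qed.

Lemma has_sumZ (c : C) F S : has_sum F S -> has_sum (fun i => c * F i) (c * S).
Proof.
move=> hS e e0; have [r r0 rE] := normc_eqR c.
(* Dividing [e] by [r + 1] instead of [r] also covers [c = 0]. *)
have r1 : 0 < r + 1 by rewrite ltr_pwDr.
have [A hA] := hS _ (divr_gt0 e0 r1).
exists A => D /hA; rewrite -mulr_sumr -mulrBr normrM rE => h.
apply: (@le_lt_trans _ _ ((r * (e / (r + 1)))%:C)%C).
  by rewrite rmorphM ler_wpM2l ?ler0c // ltW.
by rewrite ltcR mulrA ltr_pdivrMr // mulrC ltr_pM2l // ltrDl.
Qed.

Lemma eq_has_sum F G S : F =1 G -> has_sum F S -> has_sum G S.
Proof. by move=> /funext ->. Qed.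

Lemma abs_summable_le F G :
  (forall i, `|F i| <= `|G i|) -> abs_summable G -> abs_summable F.
Proof. by move=> FG [M hM]; exists M => A; apply: le_trans (hM A); apply: ler_sum. Qed.

(** The sum is the supremum of the finite partial sums: one of them comes within [e] of it, and
    monotonicity keeps all larger finite sets in between. *)
Lemma has_sum_ge0 (a : I -> R) (M : R) : (forall i, 0 <= a i) ->
  (forall A : {fset I}, \sum_(i <- A) a i <= M) ->
  exists T : R, has_sum (fun i => ((a i)%:C)%C) (T%:C)%C.
Proof.
move=> a0 aM; pose E := [set \sum_(i <- A) a i | A in [set: {fset I}]]%classic.
have hE : has_sup E.
  split; first by exists (\sum_(i <- fset0) a i), fset0.
  by exists M => _ [A _ <-].
exists (sup E) => e e0; have [_ [A _ <-] hA] := sup_adherent e0 hE.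
exists A => D AD; rewrite -rmorph_sum -rmorphB.
have DE : \sum_(i <- D) a i <= sup E by apply: (ub_le_sup hE.2); exists D.
rewrite normc_def /= expr0n addr0 ltcR sqrtr_sqr distrC ger0_norm ?subr_ge0 //.
by rewrite ltrBlDr -ltrBlDl (lt_le_trans hA) // ler_sum_fset.
Qed.

(* Real and imaginary parts are differences of the nonnegative families
   [|F| + Re F], [|F| + Im F] and [|F|]. *)
Lemma abs_summable_has_sum F : abs_summable F -> exists S, has_sum F S.
Proof.
move=> [M hM]; pose n i := complex.Re `|F i|.
have nE i : ((n i)%:C)%C = `|F i| by rewrite RRe_real ?normr_real.
have n0 i : 0 <= n i by rewrite -ler0c nE.
have sn A : \sum_(i <- A : {fset I}) n i <= M.
  by rewrite -lecR rmorph_sum (eq_bigr (fun i => `|F i|)).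
have half (p : I -> R) : (forall i, `|p i| <= n i) ->
    exists T : R, has_sum (fun i => ((n i + p i)%:C)%C) (T%:C)%C.
  move=> pn; apply: (@has_sum_ge0 _ (M + M)) => [i|A].
    by rewrite -lerBlDl sub0r; have := pn i; rewrite ler_norml => /andP[].
  rewrite big_split lerD //= (le_trans _ (sn A)) // ler_sum // => i _.
  exact: le_trans (ler_norm _) (pn i).
have reF i : `|complex.Re (F i)| <= n i by rewrite -lecR nE normc_ge_Re.
have imF i : `|complex.Im (F i)| <= n i.
  (* Multiplication by ['i] keeps the modulus and turns the imaginary part, up to sign, into the
     real part. *)
  rewrite -lecR nE -(mulr1 `|F i|) -[X in _ * X](_ : `|'i%C : C| = 1).
    by rewrite -normrM (le_trans _ (normc_ge_Re _)) // ReiNIm normrN.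
  by rewrite normc_def /= expr0n expr1n add0r sqrtr1.
have [T1 h1] := half _ reF; have [T2 h2] := half _ imF.
have [T3 h3] := has_sum_ge0 _ _ n0 sn.
(* [F = (|F| + Re F) + i (|F| + Im F) - (1 + i) |F|]. *)
eexists; have := has_sumD _ _ _ _ (has_sumD _ _ _ _ h1 (has_sumZ 'i%C _ _ h2))
  (has_sumZ (- (1 + 'i%C)) _ _ h3).
apply: eq_has_sum => i; rewrite !rmorphD /= [RHS]complexE; ring.
Qed.

Lemma has_sum_csum F : abs_summable F -> has_sum F (csum F).
Proof.
move=> /abs_summable_has_sum hF; rewrite /csum; case: pselect => // h.
exact: (projT2 (cid h)).
Qed.

End Family.

(** Fibers over distinct points are disjoint, so a finite sum of [G] is a sum of [T] over a union of
    fibers. Together the fibers cover the support of [T]. *)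
Lemma has_sum_fibers (I J : choiceType) (h : J -> I) (fib : I -> {fset J})
    (T : J -> C) (G : I -> C) S :
  (forall i j, j \in fib i -> h j = i) ->
  (forall j, T j != 0 -> j \in fib (h j)) ->
  (forall i, G i = \sum_(j <- fib i) T j) ->
  abs_summable T -> has_sum T S -> abs_summable G /\ has_sum G S.
Proof.
move=> hfib Tfib GE [M hM] hS.
have sumE (V : zmodType) (t : J -> V) (A : {fset I}) :
    \sum_(i <- A) \sum_(j <- fib i) t j = \sum_(j <- (\bigcup_(i <- A) fib i)%fset) t j.
  rewrite partition_disjoint_bigfcup // => i j _ _ ij; apply/fdisjointP => k ki.
  by apply: contra ij => kj; rewrite -(hfib _ _ ki) -(hfib _ _ kj).
split.
  exists M => A; apply: le_trans (hM (\bigcup_(i <- A) fib i)%fset).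
  rewrite -(sumE C (fun j => `|T j|)) ler_sum // => i _.
  by rewrite GE ler_norm_sum.
move=> e e0; have [B hB] := hS e e0; exists (h @` B)%fset => A /fsubsetP BA.
under eq_bigr do rewrite GE.
rewrite (sumE C T).
(* Enlarging [U] by [B] adds only zeros: if [j \in B] and [T j != 0], then [h j \in A], so [j]
   already lies in [U]. *)
set U := (\bigcup_(i <- A) fib i)%fset.
have -> : \sum_(j <- U) T j = \sum_(j <- (U `|` B)%fset) T j.
  apply: big_fset_incl; first exact: fsubsetUl.
  move=> j; rewrite !inE => /orP[->//|jB] jU.
  apply/eqP; apply: contraNT jU => /Tfib jf.
  by apply/bigfcupP; exists (h j) => //; rewrite andbT BA // in_imfset.
by apply: hB; apply: fsubsetUr.
Qed.

(** * Products of summable families over a finite index set *)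

Section Product.
Variables (T : finType) (I : choiceType).
Implicit Types (B : {fset I}) (x : {ffun T -> I}).

Definition ffun_val B (y : {ffun T -> B}) : {ffun T -> I} := [ffun t => val (y t)].

(** The cube of side [B], built as the image of a finite type so that finite distributivity applies
    to it. *)
Definition fbox B : {fset {ffun T -> I}} :=
  [fset ffun_val B y | y : {ffun T -> B}]%fset.

Lemma in_fbox B x : (x \in fbox B) = [forall t, x t \in B].
Proof.
apply/imfsetP/forallP => [[y _ ->] t|xB]; first by rewrite ffunE fsvalP.
exists [ffun t => FSetSub (xB t)] => //.
by apply/ffunP => t; rewrite !ffunE.
Qed.

Lemma sum_fbox (K : comPzSemiRingType) (F : T -> I -> K) B :
  \sum_(x <- fbox B) \prod_t F t (x t) = \prod_t \sum_(i <- B) F t i.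
Proof.
rewrite big_imfset /=; last first.
  move=> y z _ _ /ffunP yz; apply/ffunP => t; apply: val_inj.
  by have := yz t; rewrite !ffunE.
rewrite [RHS](eq_bigr (fun t => \sum_(b : B) F t (val b))) => [|t _]; last first.
  by rewrite big_seq_fsetE.
rewrite bigA_distr_bigA big_enum; apply: eq_bigr => y _.
by apply: eq_bigr => t _; rewrite ffunE.
Qed.

Lemma fsubset_fbox (A : {fset {ffun T -> I}}) B :
  (forall x t, x \in A -> x t \in B) -> fsubset A (fbox B).
Proof. by move=> AB; apply/fsubsetP => x xA; rewrite in_fbox; apply/forallP => t; apply: AB. Qed.

Definition fcoords (A : {fset {ffun T -> I}}) : {fset I} :=
  (\bigcup_(x <- A) [fset x t | t in T])%fset.

Lemma mem_fcoords A x t : x \in A -> x t \in fcoords A.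
Proof.
move=> xA; apply/bigfcupP; exists x; rewrite ?xA //.
by apply/imfsetP; exists t.
Qed.

(** Any finite [A] lies in a cube, over which the sum of the moduli factors into sums bounded by the
    [M t]. *)
Lemma abs_summable_prod (F : T -> I -> C) : (forall t, abs_summable (F t)) ->
  abs_summable (fun x : {ffun T -> I} => \prod_t F t (x t)).
Proof.
move=> /choice[M hM]; exists (\prod_t M t) => A.
have AB : fsubset A (fbox (fcoords A)).
  by apply: fsubset_fbox => x t; apply: mem_fcoords.
apply: le_trans (ler_sum_fset _ _ _ _ _ AB _) _ => //.
rewrite (eq_bigr (fun x : {ffun T -> I} => \prod_t `|F t (x t)|)) => [|x _]; last first.
  by rewrite normr_prod.
rewrite (sum_fbox _ (fun t i => `|F t i|)) rmorph_prod ler_prod // => t _.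
by rewrite sumr_ge0 //= hM.
Qed.

Lemma prod_near (S : T -> C) (r : seq T) (e : R) : 0 < e ->
  exists2 d : R, 0 < d & forall a : T -> C, (forall t, `|a t - S t| < (d%:C)%C) ->
    `|\prod_(t <- r) a t - \prod_(t <- r) S t| < (e%:C)%C.
Proof.
elim: r e => [|t r IH] e e0.
  by exists 1 => // a _; rewrite !big_nil subrr normr0 ltcR.
have [p p0 pE] := normc_eqR (\prod_(u <- r) S u); have [q q0 qE] := normc_eqR (S t).
have q1 : 0 < q + 1 by rewrite ltr_pwDr.
have p1 : 0 < p + 1 by rewrite ltr_pwDr.
have [d d0 hd] := IH _ (divr_gt0 (divr_gt0 e0 (ltr0Sn _ 1)) q1).
(* The bound 1 gives [|a t| <= q + 1], [d] controls the tail, and the third bound makes the error in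
   the head, times [p], at most [e / 2]. *)
exists (Num.min 1 (Num.min d (e / 2 / (p + 1)))) => [|a ha].
  by rewrite !lt_min ltr01 d0 !divr_gt0.
have ha1 u : `|a u - S u| < 1 by apply: lt_le_trans (ha u) _; rewrite lecR ge_min lexx.
have ha2 u : `|a u - S u| < (d%:C)%C.
  by apply: lt_le_trans (ha u) _; rewrite lecR !ge_min lexx orbT.
have ha3 u : `|a u - S u| < ((e / 2 / (p + 1))%:C)%C.
  by apply: lt_le_trans (ha u) _; rewrite lecR !ge_min lexx !orbT.
rewrite !big_cons.
have -> : a t * \prod_(u <- r) a u - S t * \prod_(u <- r) S u =
    a t * (\prod_(u <- r) a u - \prod_(u <- r) S u) +
    (a t - S t) * \prod_(u <- r) S u by ring.
apply: le_lt_trans (ler_normD _ _) _; rewrite !normrM pE -(halvesC e).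
apply: ltr_leD.
  have -> : e / 2 = (q + 1) * (e / 2 / (q + 1)) by rewrite mulrCA mulfV ?mulr1 ?gt_eqF.
  rewrite rmorphM; apply: (@le_lt_trans _ _ (((q + 1)%:C)%C *
      `|\prod_(u <- r) a u - \prod_(u <- r) S u|)).
    apply: ler_wpM2r => //; rewrite -(subrK (S t) (a t)) (le_trans (ler_normD _ _)) //.
    by rewrite qE addrC rmorphD lerD2l ltW.
  have qC : 0 < ((q + 1)%:C : C)%C by rewrite (ltcR 0).
  by rewrite (ltr_pM2l qC); apply: hd.
apply: (@le_trans _ _ (((e / 2 / (p + 1)) * (p + 1))%:C)%C).
  by rewrite rmorphM; apply: ler_pM (normr_ge0 _) _ (ltW (ha3 t)) _; rewrite /= ?ler0c // lecR lerDl.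
by rewrite divfK // gt_eqF.
Qed.

(** Absolute convergence provides some sum [P]. Partial sums over large cubes are products of
    partial sums, hence close both to [P] and to the product of the [S t]. *)
Lemma has_sum_prod (F : T -> I -> C) (S : T -> C) :
  (forall t, abs_summable (F t)) -> (forall t, has_sum (F t) (S t)) ->
  has_sum (fun x : {ffun T -> I} => \prod_t F t (x t)) (\prod_t S t).
Proof.
move=> aF hF; have [P hP] := abs_summable_has_sum _ _ (abs_summable_prod _ aF).
suff -> : \prod_t S t = P by [].
apply/eqP; rewrite -subr_eq0 -normr_eq0.
have [r r0 rE] := normc_eqR (\prod_t S t - P); rewrite rE.
have [->//|rN0] := eqVneq r 0.
have e0 : 0 < r / 2 by rewrite divr_gt0 // lt0r rN0.
have [d d0 hd] := prod_near S (index_enum T) _ e0.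
have /choice[B hB] t := hF t _ d0; have [A hA] := hP _ e0.
(* The cube of side [D] contains [A], and [D] itself contains every [B t]. *)
pose D := (fcoords A `|` (\bigcup_(t <- index_enum T) B t))%fset.
have h1 : `|\prod_t \sum_(i <- D) F t i - \prod_t S t| < ((r / 2)%:C)%C.
  apply: hd => t; apply: hB; apply: fsubset_trans (fsubsetUr _ _).
  by apply/fsubsetP => i iB; apply/bigfcupP; exists t; rewrite ?mem_index_enum.
have h2 : `|\prod_t \sum_(i <- D) F t i - P| < ((r / 2)%:C)%C.
  rewrite -sum_fbox; apply: hA; apply: fsubset_fbox => x t xA.
  by rewrite inE mem_fcoords.
have := ltrD h1 h2; rewrite halvesC -rE distrC => h.
have := ler_normD (\prod_t S t - \prod_t \sum_(i <- D) F t i)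
  (\prod_t \sum_(i <- D) F t i - P).
by rewrite addrA subrK => /le_lt_trans /(_ h); rewrite ltxx.
Qed.

End Product.
End ComplexSums.

(** * Terms of Dirichlet series and their absolute convergence *)

Section DirichletTerms.
Variable R : realType.
Local Notation C := R[i].
Implicit Types (s : C) (f : arith R).

Lemma npowND n s t : npowN n (s + t) = npowN n s * npowN n t.
Proof.
case: s t => a b [c d]; rewrite /npowN /= opprD !mulrDl expRD cosD sinD.
apply/eqP; rewrite eq_complex /=; apply/andP; split; apply/eqP; ring.
Qed.

Lemma npowNM n k s : (0 < n)%N -> (0 < k)%N ->
  npowN (n * k) s = npowN n s * npowN k s.
Proof.
case: s => a b n0 k0; rewrite /npowN /= natrM lnM ?posrE ?ltr0n //.
rewrite !mulrDr expRD cosD sinD.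
apply/eqP; rewrite eq_complex /=; apply/andP; split; apply/eqP; ring.
Qed.

Lemma npowN1 s : npowN 1 s = 1.
Proof. by rewrite /npowN ln1 !mulr0 expR0 cos0 sin0 mulr0 subr0 mulr1. Qed.

Lemma npowN0 n : npowN n (0 : C) = 1.
Proof. by rewrite /npowN /= oppr0 !mul0r expR0 cos0 sin0 mulr0 subr0 mulr1. Qed.

Lemma normc_npowN n s :
  `|npowN n s| = ((expR (- complex.Re s * ln (n%:R : R)))%:C)%C.
Proof.
rewrite /npowN normrM [X in _ * X](_ : _ = 1) ?mulr1; last first.
  rewrite normc_def /= !(mul0r, mul1r, mulr0, oppr0, addr0, add0r, subr0).
  by rewrite sqrrN cos2Dsin2 sqrtr1.
by rewrite normc_def /= expr0n addr0 sqrtr_sqr ger0_norm // expR_ge0.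
Qed.

Lemma abs_summable_dterm_le f s t : complex.Re s <= complex.Re t ->
  abs_summable (dterm f s) -> abs_summable (dterm f t).
Proof.
move=> st; apply: abs_summable_le => -[//|n]; rewrite /dterm !(normrM (f _)) ler_wpM2l //.
by rewrite !normc_npowN lecR ler_expR ler_wpM2r ?lerN2 // ln_ge0 // ler1n.
Qed.

(** Below [Re s] the infimum leaves some real exponent [x] of absolute convergence, which then
    passes to larger real parts. *)
Lemma abs_summable_abscissa f s : (abscissa f < (complex.Re s)%:E)%E ->
  abs_summable (dterm f s).
Proof.
move=> /ereal_inf_lt[_ [x /= hx <-]]; rewrite lte_fin => xs.
by apply: abs_summable_dterm_le hx; apply: ltW.
Qed.

Lemma abs_summable_restr g f s :
  abs_summable (dterm f s) -> abs_summable (dterm (restr g f) s).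
Proof.
apply: abs_summable_le => -[|n] //=; rewrite /restr /agam -mulrA normrM.
by case: is_pow; rewrite ?normr1 ?mul1r // normr0 mul0r.
Qed.

(* The dyadic block [2^k <= n < 2^(k+1)] contributes at most [q^k],
   where [q = 2^(1 - x) < 1]. *)
Lemma sum_dyadic_le (x : R) (k : nat) : 1 < x ->
  \sum_(1 <= n < 2 ^ k) expR (- x * ln (n%:R : R)) <=
  \sum_(i < k) expR ((1 - x) * ln 2) ^+ i.
Proof.
move=> x1; elim: k => [|k IH]; first by rewrite expn0 big_geq // big_ord0.
rewrite big_ord_recr /= (@big_cat_nat _ _ _ (2 ^ k)) /=; last 2 first.
- by rewrite expn_gt0.
- by rewrite leq_exp2l.
apply: lerD => //.
(* Each term is at most its value at the left end; the [2 ^ k] equal terms then add up to exactly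
   [q^k]. *)
apply: (@le_trans _ _ (\sum_(2 ^ k <= n < 2 ^ k.+1) expR (- x * ln ((2 ^ k)%:R : R)))).
  rewrite big_nat_cond [leRHS]big_nat_cond; apply: ler_sum => n /andP[/andP[kn _] _].
  have p0 : (0 < 2 ^ k)%N by rewrite expn_gt0.
  rewrite ler_expR; apply: ler_wnM2l; first by rewrite oppr_le0; lra.
  by rewrite ler_ln ?posrE ?ltr0n ?(leq_trans p0) // ler_nat.
rewrite sumr_const_nat expnS mul2n -addnn addnK -[leLHS]mulr_natl.
have -> : (2 ^ k)%:R = expR (k%:R * ln 2) :> R.
  by rewrite expRM_natl lnK ?posrE ?ltr0n // natrX.
rewrite expRK -expRD -expRM_natl le_eqVlt; apply/orP; left; apply/eqP.
congr expR; ring.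
Qed.

Lemma abs_summable_zeta s : 1 < complex.Re s -> abs_summable (dterm (fun=> 1) s).
Proof.
move=> s1; set x := complex.Re s; pose q := expR ((1 - x) * ln 2).
have q1 : q < 1.
  by rewrite expR_lt1 pmulr_llt0 ?subr_lt0 // ln_gt0 // ltr1n.
have q0 : 0 <= q by rewrite expR_ge0.
exists (1 - q)^-1 => A.
pose N := (\max_(i <- A) i).+1; pose B := seq_fset tt (iota 0 N).
have AB : fsubset A B.
  apply/fsubsetP => i iA; rewrite seq_fsetE mem_iota ltnS; exact: leq_bigmax_seq.
apply: le_trans (ler_sum_fset _ _ _ _ _ AB _) _ => //.
have -> : \sum_(i <- B) `|dterm (fun=> 1) s i| =
          \sum_(0 <= i < N) `|dterm (fun=> 1) s i|.
  apply: perm_big; apply: uniq_perm; rewrite ?iota_uniq //.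
  by move=> i; rewrite seq_fsetE /index_iota subn0.
rewrite big_ltn //= normr0 add0r.
apply: (@le_trans _ _ ((\sum_(1 <= n < 2 ^ N) expR (- x * ln (n%:R : R)))%:C)%C).
  have NN : (N <= 2 ^ N)%N by apply/ltnW/ltn_expl.
  rewrite rmorph_sum [leRHS](@big_cat_nat _ _ _ N) //= -[leLHS]addr0.
  apply: lerD; last by rewrite sumr_ge0 // => i _; rewrite ler0c expR_ge0.
  rewrite big_nat_cond [leRHS]big_nat_cond; apply: ler_sum => -[|i] //= _.
  by rewrite mul1r normc_npowN.
rewrite lecR (le_trans (sum_dyadic_le _ _ s1)) // -/q.
rewrite -(ler_pM2l (_ : 0 < 1 - q)) ?subr_gt0 // mulfV ?gt_eqF ?subr_gt0 //.
(* [(1 - q) (1 + q + ... + q^(N-1)) = 1 - q^N <= 1]. *)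
rewrite -[1 - q]opprB mulNr -subrX1 opprB lerBlDr lerDl exprn_ge0 //.
Qed.

End DirichletTerms.

(** * Perfect powers *)

Lemma is_powP g n : reflect (exists d, d ^ g = n)%N (is_pow g n).
Proof.
apply: (iffP existsP) => [[d /eqP]|[d dn]]; first by exists d.
(* For exponent 0 any base works, so 0 is taken; otherwise [d <= d ^ g = n]. *)
case: g dn => [|g] dn; first by exists ord0; apply/eqP.
have dn1 : (d < n.+1)%N.
  rewrite ltnS -dn; case: d {dn} => [//|d].
  by rewrite expnS leq_pmulr // expn_gt0.
by exists (Ordinal dn1); apply/eqP.
Qed.

Lemma is_pow_mul g a b : is_pow g a -> is_pow g b -> is_pow g (a * b).
Proof.
by move=> /is_powP[c <-] /is_powP[d <-]; apply/is_powP; exists (c * d)%N; rewrite expnMn.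
Qed.

(** For [g > 0], [d ^ g %| c ^ g] forces [d %| c], so the quotient is the power of [c %/ d]. *)
Lemma is_pow_div g a b : (0 < g)%N -> (0 < b)%N -> (b %| a)%N ->
  is_pow g a -> is_pow g b -> is_pow g (a %/ b).
Proof.
move=> g0 b0 ba /is_powP[c ac] /is_powP[d bd].
move: ba b0; rewrite -ac -bd dvdn_pexp2r // => /dvdnP[e ->] d0.
by apply/is_powP; exists e; rewrite expnMn mulnK.
Qed.

Lemma is_pow_dvd g h a : (g %| h)%N -> is_pow h a -> is_pow g a.
Proof.
move=> /dvdnP[k ->] /is_powP[d <-]; apply/is_powP; exists (d ^ k)%N.
by rewrite -expnM.
Qed.

Lemma is_pow1 n : is_pow 1 n.
Proof. by apply/is_powP; exists n; rewrite expn1. Qed.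

(** * Divisor chains ending in 1 *)

Section DivisorChains.
Variables (M : nat) (D : nat -> nat).
Hypothesis D_top : D M = 1%N.
Hypothesis D_dvd : forall k, (k < M)%N -> (D k.+1 %| D k)%N.

(** The product telescopes to [D k / D M]; the induction runs downwards from [k = M]. *)
Lemma prod_chain k : (k <= M)%N ->
  (\prod_(k <= l < M) (D l %/ D l.+1))%N = D k.
Proof.
move=> kM; rewrite -(subKn kM); elim: (M - k)%N (leq_subr k M) => [|j IH] jM.
  by rewrite subn0 big_geq // D_top.
rewrite big_ltn; last by rewrite -subSn // subSS leq_subr.
have E : ((M - j.+1).+1 = M - j)%N by rewrite -subSn // subSS.
by rewrite E IH ?(ltnW jM) // divnK // -E D_dvd // E leq_subr.
Qed.

Lemma chain_dvd i j : (i <= j <= M)%N -> (D j %| D i)%N.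
Proof.
case/andP; elim: j => [|j IH]; first by rewrite leqn0 => /eqP ->.
rewrite leq_eqVlt => /orP[/eqP -> //|ij] jM.
by apply: dvdn_trans (IH ij (ltnW jM)); apply: D_dvd.
Qed.

Hypothesis D_gt0 : forall k, (k <= M)%N -> (0 < D k)%N.

(* Abel summation in multiplicative form. *)
Lemma prod_npowN_chain (R : realType) (s : nat -> R[i]) :
  \prod_(0 <= i < M) npowN (D i) (s i.+1) =
  \prod_(0 <= i < M) npowN (D i %/ D i.+1) (\sum_(1 <= l < i.+2) s l).
Proof.
(* The partial identity carries the boundary term of Abel summation, which becomes 1 at [k = M]
   because [D M = 1]. *)
suff H k : (k <= M)%N -> \prod_(0 <= i < k) npowN (D i) (s i.+1) =
    (\prod_(0 <= i < k) npowN (D i %/ D i.+1) (\sum_(1 <= l < i.+2) s l)) *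
    npowN (D k) (\sum_(1 <= l < k.+1) s l).
  by rewrite H // D_top npowN1 mulr1.
elim: k => [_|k IH kM]; first by rewrite !big_geq // npowN0 mulr1.
rewrite big_nat_recr //= IH 1?ltnW // [X in _ = X * _]big_nat_recr //=.
rewrite -[LHS]mulrA -[RHS]mulrA; congr (_ * _).
rewrite -npowND -big_nat_recr //=.
have d0 : (0 < D k %/ D k.+1)%N by rewrite divn_gt0 ?D_gt0 // dvdn_leq ?D_gt0 ?D_dvd // ltnW.
by rewrite -npowNM ?D_gt0 // divnK // D_dvd.
Qed.

End DivisorChains.

(** * The change of variables for Ramanujan sums *)

Section RamanujanFibers.
Variables (R : realType) (m : nat) (f : nat -> arith R) (g : nat -> nat) (s : nat -> R[i]).
Hypothesis g_gt0 : forall j, (j <= m)%N -> (0 < g j)%N.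
Hypothesis g_dvd : forall j, (j < m)%N -> (g j %| g j.+1)%N.
Local Notation C := R[i].
Local Notation point := {ffun 'I_m.+1 -> nat}.
Local Notation params := {ffun 'I_m.+1 + 'I_m.+1 -> nat}.

(* In the paper's notation, for [n_1 = n] and [d_j = d (j - 1)]:
   [D_0 = n_1], [D_j = d_j ^ gamma_j] for [1 <= j <= m], [D_(m+1) = 1]. *)
Definition chain (n : nat) (d : nat -> nat) (k : nat) : nat :=
  if k == m.+1 then 1%N else if k is k'.+1 then (d k' ^ g k)%N else n.

Definition tuple_entry (n : nat) (t : m.-tuple 'I_n) (j : nat) : nat := nth 0%N (map val t) j.

Local Notation chainx x t := (chain (x (inord 0)) (tuple_entry _ t)).

(** These are the tuples whose quotients [k_j] and [e_j] are exact positive integers; all other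
    terms of the Ramanujan sum vanish. *)
Definition admissible (x : point) (t : m.-tuple 'I_(x (inord 0)).+1) : bool :=
  [&& [forall i, (0 < x i)%N], [forall j : 'I_m, (0 < tuple_entry _ t j)%N],
      [forall k : 'I_m.+1, (chainx x t k.+1 %| chainx x t k)%N] &
      [forall i : 'I_m.+1, (chainx x t i %| x i)%N]].

(* The change of variables [k_j = D_(j-1) / D_j], [e_j = n_j / D_(j-1)]:
   [inl] carries the [k_j] and [inr] the [e_j]; its inverse is
   [n_j = k_j k_(j+1) .. k_(m+1) e_j], and [e_1 = 1]. *)
Definition to_params (x : point) (t : m.-tuple 'I_(x (inord 0)).+1) : params :=
  [ffun u : ('I_m.+1 + 'I_m.+1)%type => match u with
   | inl i => (chainx x t i %/ chainx x t i.+1)%N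
   | inr i => (x i %/ chainx x t i)%N
   end].

Definition of_params (y : params) : point :=
  [ffun i : 'I_m.+1 =>
     ((\prod_((i : nat) <= l < m.+1) y (inl (inord l))) * y (inr i))%N].

(** That [n_1] is a [gamma_0]-th power is not imposed here: [factor] vanishes at parameters
    violating it. *)
Definition fiber (x : point) : {fset params} :=
  [fset to_params x t | t in [pred t | admissible x t]]%fset.

(** The indicator of 1 pins [e_1 = 1]; its sum is 1, so the zeta factors start at [s_2]. *)
Definition factor (u : 'I_m.+1 + 'I_m.+1) : nat -> C :=
  match u with
  | inl i => dterm (restr (g i) (f i.+1)) (\sum_(1 <= l < i.+2) s l)
  | inr i => if i == ord0 then fun n => (n == 1%N)%:R else dterm (fun=> 1) (s i.+1)
  end.

(** * Terms attached to an admissible tuple *)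

Section Admissible.
Variables (x : point) (t : m.-tuple 'I_(x (inord 0)).+1).
Hypothesis xt : admissible x t.
Local Notation D := (chainx x t).

Lemma adm_x_gt0 i : (0 < x i)%N.
Proof. by case/and4P: xt => /forallP. Qed.

Lemma chain_top : D m.+1 = 1%N.
Proof. by rewrite /chain eqxx. Qed.

Lemma chain0 : D 0 = x (inord 0).
Proof. by []. Qed.

Lemma chainS k : (k < m)%N -> D k.+1 = (tuple_entry _ t k ^ g k.+1)%N.
Proof. by move=> km; rewrite /chain eqSS ltn_eqF. Qed.

Lemma adm_chain_gt0 k : (k <= m.+1)%N -> (0 < D k)%N.
Proof.
case: k => [_|k]; first exact: adm_x_gt0.
rewrite ltnS leq_eqVlt => /orP[/eqP ->|km]; first by rewrite chain_top.
rewrite chainS // expn_gt0; case/and4P: xt => _ /forallP/(_ (Ordinal km)) /= -> _ _.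
by [].
Qed.

Lemma adm_chain_dvd k : (k < m.+1)%N -> (D k.+1 %| D k)%N.
Proof. by move=> km; case/and4P: xt => _ _ /forallP/(_ (Ordinal km)). Qed.

Lemma adm_chain_dvdx (i : 'I_m.+1) : (D i %| x i)%N.
Proof. by case/and4P: xt => _ _ _ /forallP. Qed.

Lemma chain_is_pow k : (0 < k <= m)%N -> is_pow (g k) (D k).
Proof. by case: k => // k km; apply/is_powP; exists (tuple_entry _ t k); rewrite chainS. Qed.

Lemma to_paramsK : of_params (to_params x t) = x.
Proof.
apply/ffunP => i; rewrite !ffunE.
rewrite (eq_big_nat _ _ (F2 := fun l => D l %/ D l.+1)%N) => [|l /andP[_ lm]]; last first.
  by rewrite ffunE inordK.
rewrite (prod_chain m.+1 D chain_top adm_chain_dvd _ (ltnW (ltn_ord i))).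
by rewrite mulnC divnK // adm_chain_dvdx.
Qed.

(** [D_(k+1)] is also a [gamma_k]-th power since [gamma_k] divides [gamma_(k+1)]. For [k > 0] so is
    [D_k]; for [k = 0] dividing by [D_1] neither creates nor destroys the property for [n_1]. *)
Lemma is_pow_quotient k : (k <= m)%N ->
  is_pow (g k) (D k %/ D k.+1) = if k == 0%N then is_pow (g 0%N) (x (inord 0)) else true.
Proof.
move=> km; have k1 : is_pow (g k) (D k.+1).
  move: km; rewrite leq_eqVlt => /orP[/eqP ->|km].
    by rewrite chain_top; apply/is_powP; exists 1%N; rewrite exp1n.
  by apply: is_pow_dvd (g_dvd _ km) _; apply: chain_is_pow.
have D0 : (0 < D k.+1)%N by apply: adm_chain_gt0.
have Dd : (D k.+1 %| D k)%N by apply: adm_chain_dvd.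
case: eqP => [k0|/eqP k0]; last first.
  by rewrite is_pow_div // ?g_gt0 // chain_is_pow // lt0n k0.
rewrite k0 in k1 D0 Dd *; apply/idP/idP => h; last by rewrite is_pow_div // g_gt0.
by rewrite -chain0 -(divnK Dd) is_pow_mul.
Qed.

Lemma prod_factor :
  \prod_u factor u (to_params x t u) =
  agam R (g 0%N) (x (inord 0)) *
  ((\prod_(1 <= k < m.+1) fdiv (f k) (D k.-1) (D k)) * f m.+1 (D m)) *
  \prod_i npowN (x i) (s i.+1).
Proof.
have K0 k : (k <= m)%N -> (0 < D k %/ D k.+1)%N.
  by move=> km; rewrite divn_gt0 ?adm_chain_gt0 // dvdn_leq ?adm_chain_dvd ?adm_chain_gt0 // ltnW.
have E0 i : (0 < x i %/ D i)%N.
  rewrite divn_gt0; last by rewrite adm_chain_gt0 // ltnW.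
  by rewrite dvdn_leq ?adm_chain_dvdx ?adm_x_gt0.
rewrite big_sumType /=.
(* At [i = 0] the quotient is 1, so an extra factor with exponent [s_1] is harmless. *)
have -> : \prod_i factor (inr i) (to_params x t (inr i)) =
    \prod_i npowN (x i %/ D i) (s i.+1).
  apply: eq_bigr => i _; rewrite ffunE /=; have := E0 i; case: eqP => [-> _|_].
    have -> : x ord0 = x (inord 0) by congr (x _); apply: val_inj; rewrite /= inordK.
    by rewrite chain0 divnn adm_x_gt0 npowN1.
  by case: (_ %/ _)%N => // n _ /=; rewrite mul1r.
have -> : \prod_i factor (inl i) (to_params x t (inl i)) =
    (\prod_(i < m.+1) agam R (g i) (D i %/ D i.+1)) *
    (\prod_(i < m.+1) f i.+1 (D i %/ D i.+1)%N) *
    \prod_(i < m.+1) npowN (D i %/ D i.+1) (\sum_(1 <= l < i.+2) s l).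
  rewrite -!big_split /=; apply: eq_bigr => i _; rewrite ffunE.
  by have := K0 i (ltn_ord i); case: (_ %/ _)%N.
have -> : \prod_(i < m.+1) agam R (g i) (D i %/ D i.+1) = agam R (g 0%N) (x (inord 0)).
  rewrite big_ord_recl big1 => [|i _]; first by rewrite mulr1 /agam is_pow_quotient.
  by rewrite /agam is_pow_quotient //= lift0.
have -> : \prod_(i < m.+1) f i.+1 (D i %/ D i.+1)%N =
    (\prod_(1 <= k < m.+1) fdiv (f k) (D k.-1) (D k)) * f m.+1 (D m).
  rewrite big_ord_recr /= chain_top divn1 big_add1 /= big_mkord; congr (_ * _).
  apply: eq_bigr => i _; have im : (i < m.+1)%N by apply: leq_trans (ltn_ord i) _.
  by rewrite /fdiv /= !adm_chain_gt0 ?adm_chain_dvd // ltnW.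
(* Abel summation returns the powers of [D_i], which then merge with those of [e_(i+1)] into powers
   of [n_(i+1)]. *)
have -> : \prod_(i < m.+1) npowN (D i %/ D i.+1) (\sum_(1 <= l < i.+2) s l) =
    \prod_(i < m.+1) npowN (D i) (s i.+1).
  rewrite -(big_mkord predT (fun i => npowN (D i) (s i.+1))).
  by rewrite (prod_npowN_chain m.+1 D chain_top adm_chain_dvd adm_chain_gt0) big_mkord.
rewrite -!mulrA; congr (_ * _); congr (_ * _); congr (_ * _).
rewrite -big_split; apply: eq_bigr => i _ /=.
rewrite -npowNM ?E0 ?adm_chain_gt0 // 1?ltnW //.
by rewrite mulnC divnK // adm_chain_dvdx.
Qed.

End Admissible.

(** * Fibers of the change of variables *)

Lemma fiber_of_params (x : point) (y : params) : y \in fiber x -> of_params y = x.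
Proof. by case/imfsetP => t /to_paramsK + ->. Qed.

(** The quotients determine the chain, as it ends in 1, and roots of positive order recover the
    [d_j]. *)
Lemma to_params_inj (x : point) : {in [pred t | admissible x t] &, injective (to_params x)}.
Proof.
move=> t t'; rewrite !inE => xt xt' /ffunP yE.
have DE k : (k <= m.+1)%N -> chainx x t k = chainx x t' k.
  move=> km; rewrite -(prod_chain m.+1 (chainx x t) (chain_top _ _) (adm_chain_dvd _ _ xt)) //.
  rewrite -(prod_chain m.+1 (chainx x t') (chain_top _ _) (adm_chain_dvd _ _ xt')) //.
  apply: eq_big_nat => l /andP[_ lm].
  by have := yE (inl (Ordinal lm)); rewrite !ffunE.
apply: eq_from_tnth => j; apply: val_inj.
have := DE j.+1 (ltnW (ltn_ord j)); rewrite !chainS // => /eqP.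
rewrite eqn_exp2r ?g_gt0 // /tuple_entry => /eqP.
by rewrite !(nth_map (tnth t j)) ?size_tuple // -!tnth_nth.
Qed.

(** Allows the gcd conditions to be exchanged for admissibility: the two index sets differ only by
    zero terms. *)
Lemma ramS_term_adm (x : point) (t : m.-tuple 'I_(x (inord 0)).+1) :
  [forall i, (0 < x i)%N] ->
  let U := (\prod_(1 <= k < m.+1) fdiv (f k) (chainx x t k.-1) (chainx x t k)) *
    f m.+1 (chainx x t m) in
  let P := [forall j : 'I_m, (0 < tuple_entry _ t j)%N &&
     (tuple_entry _ t j ^ g j.+1 %| \big[gcdn/0%N]_(1 <= i < j.+3) x (inord i.-1))%N] in
  (admissible x t -> P) /\ (P -> ~~ admissible x t -> U = 0).
Proof.
move=> x0 U P; split.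
  move=> xt; apply/forallP => j; apply/andP; split.
    by case/and4P: xt => _ /forallP/(_ j).
  rewrite -(chainS x) // big_add1 big_mkord; apply/dvdn_biggcdP => i _ /=.
  have im : (i < m.+1)%N by apply: leq_trans (ltn_ord i) _; rewrite ltnS.
  apply: dvdn_trans (adm_chain_dvdx _ _ xt (inord i)); rewrite inordK //.
  apply: (chain_dvd m.+1) => //; first exact: adm_chain_dvd.
  by rewrite -ltnS ltn_ord /= ltnS ltnW.
move=> /forallP Pt; apply: contraNeq => U0.
(* A broken divisibility would make one [fdiv] factor, hence [U], zero. *)
have Ddvd k : (k < m)%N -> (chainx x t k.+1 %| chainx x t k)%N.
  move=> km; apply: contraNT U0 => nd.
  rewrite /U (bigD1_seq k.+1) ?iota_uniq ?mem_index_iota //=.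
  by rewrite /fdiv (negPf nd) !andbF !mul0r.
rewrite /admissible x0 /=; apply/and3P; split; apply/forallP.
- by move=> j; case/andP: (Pt j).
- move=> k; have := ltn_ord k; rewrite ltnS leq_eqVlt => /orP[/eqP ->|/Ddvd //].
  by rewrite chain_top dvd1n.
case=> -[|k] km /=; first by rewrite (_ : Ordinal km = inord 0) //; apply: val_inj; rewrite /= inordK.
have /andP[_ ] := Pt (Ordinal (km : (k < m)%N)); rewrite -(chainS x) // big_add1 big_mkord.
(* Only the last entry of the gcd is used: it yields [D_(k+1) | n_(k+2)]. *)
move=> /dvdn_biggcdP/(_ ord_max isT) /=.
by rewrite (_ : inord k.+1 = Ordinal km) //; apply: val_inj; rewrite /= inordK.
Qed.

Lemma ramS_chain (x : point) :
  ramS m g f (fun j => x (inord j.-1)) =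
  \sum_(t : m.-tuple 'I_(x (inord 0)).+1 |
      [forall j : 'I_m, (0 < tuple_entry _ t j)%N &&
        (tuple_entry _ t j ^ g j.+1 %| \big[gcdn/0%N]_(1 <= i < j.+3) x (inord i.-1))%N])
    (\prod_(1 <= k < m.+1) fdiv (f k) (chainx x t k.-1) (chainx x t k)) *
    f m.+1 (chainx x t m).
Proof.
apply: eq_bigr => t _ /=; rewrite /chain ltn_eqF //; congr (_ * _).
apply: eq_big_nat => k /andP[_ km]; rewrite !ltn_eqF //.
by rewrite (leq_ltn_trans (leq_pred k)).
Qed.

Lemma mterm_fiber (x : point) :
  mterm (fun x : point => agam R (g 0%N) (x (inord 0)) *
           ramS m g f (fun j => x (inord j.-1))) (fun i => s i.+1) x =
  \sum_(y <- fiber x) \prod_u factor u (y u).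
Proof.
rewrite /fiber big_imfset /=; last exact: to_params_inj.
rewrite big_enum_cond /= [RHS](eq_bigl (admissible x)) => [|t]; last by rewrite andbT.
under [RHS]eq_bigr => t xt do rewrite (prod_factor x t xt).
rewrite /mterm.
case: ifP => [x0|/negbT x0]; last first.
  rewrite big1 // => t; case/and4P; by rewrite (negPf x0).
rewrite -mulr_suml -mulr_sumr; congr (_ * _ * _); rewrite ramS_chain.
rewrite big_mkcond [RHS]big_mkcond; apply: eq_bigr => t _.
have [h1 h2] := ramS_term_adm x t x0.
case: (boolP (admissible x t)) => [/h1 -> //|nxt]; case: ifP => // Pt.
exact: h2.
Qed.

(** Nonvanishing makes all parameters positive, [e_1 = 1], and each [k_j] a [gamma_(j-1)]-th power.
    The tail products of the [k_j] then form the chain, and their roots give the tuple. *)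
Lemma factor_fiber (y : params) : \prod_u factor u (y u) != 0 -> y \in fiber (of_params y).
Proof.
move=> y0; have y0u u : factor u (y u) != 0.
  by apply: contraNneq y0 => h; rewrite (bigD1 u) //= h mul0r.
have K0 i : (0 < y (inl i))%N by have := y0u (inl i); case: (y _) => //=; rewrite eqxx.
have Kp (i : 'I_m.+1) : is_pow (g i) (y (inl i)).
  have := y0u (inl i); case: (y _) => [|n] /=; first by rewrite eqxx.
  by rewrite /restr /agam; case: is_pow => //; rewrite !mul0r eqxx.
have E0 : y (inr ord0) = 1%N.
  by have := y0u (inr ord0); rewrite /= pnatr_eq0 eqb0 negbK => /eqP.
have Ei i : (0 < y (inr i))%N.
  have := y0u (inr i) => /=; case: (i =P ord0) => [-> _|_]; first by rewrite E0.
  by case: (y _) => //=; rewrite eqxx.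
pose P k := (\prod_(k <= l < m.+1) y (inl (inord l)))%N.
have P0 k : (0 < P k)%N by rewrite prodn_gt0.
have PS k : (k < m.+1)%N -> P k = (y (inl (inord k)) * P k.+1)%N.
  by move=> km; rewrite /P big_ltn.
have Ptop : P m.+1 = 1%N by rewrite /P big_geq.
have Pd k : (k < m.+1)%N -> (P k.+1 %| P k)%N by move=> km; rewrite (PS k km) dvdn_mull.
(* Downward induction: [P k.+1] is a [g k.+1]-th power, hence a [g k]-th power, and so is the new
   factor. *)
have Pp k : (k <= m)%N -> is_pow (g k) (P k).
  move=> km; rewrite -(subKn km); elim: (m - k)%N (leq_subr k m) => [|j IH] jm.
    by rewrite subn0 PS // Ptop muln1 -[X in is_pow (g X)](@inordK m).
  have E : ((m - j.+1).+1 = m - j)%N by rewrite -subSn // subSS.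
  have lt1 : (m - j.+1 < m)%N by rewrite E leq_subr.
  rewrite PS 1?ltnW // is_pow_mul //.
    by rewrite -[X in is_pow (g X)](@inordK m) // ltnW.
  by apply: is_pow_dvd (g_dvd _ lt1) _; rewrite E; apply: IH; apply: ltnW.
have /choice[r hr] j : exists d, (j < m)%N -> (d ^ g j.+1 = P j.+1)%N.
  case: (ltnP j m) => [/Pp/is_powP[d dE]|_]; first by exists d.
  by exists 0%N.
pose x := of_params y; have xE i : x i = (P i * y (inr i))%N by rewrite ffunE.
have x0 : x (inord 0) = P 0%N.
  by rewrite xE inordK // (_ : inord 0 = ord0) ?E0 ?muln1 //; apply: val_inj; rewrite /= inordK.
(* A root is at most its power [P j.+1], which divides [P 0 = n_1]; so it fits the range of the
   tuple entries. *)
have rx j : (j < m)%N -> (r j < (x (inord 0)).+1)%N.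
  move=> jm; rewrite ltnS x0; apply: (@leq_trans (P j.+1)).
    rewrite -hr //; case: (r j) => // d; have := g_gt0 _ jm; case: (g _) => // h _.
    by rewrite expnS leq_pmulr // expn_gt0.
  by rewrite dvdn_leq // (chain_dvd m.+1) //= ltnW.
pose t : m.-tuple 'I_(x (inord 0)).+1 := [tuple inord (r j) | j < m].
have tE j : (j < m)%N -> tuple_entry _ t j = r j.
  move=> jm; rewrite /tuple_entry (nth_map (inord 0)) ?size_tuple //.
  by rewrite -(tnth_nth _ t (Ordinal jm)) tnth_mktuple; exact: inordK (rx _ jm).
have DE k : (k <= m.+1)%N -> chainx x t k = P k.
  case: k => [_|k]; first by rewrite chain0 x0.
  rewrite ltnS leq_eqVlt => /orP[/eqP ->|km]; first by rewrite chain_top Ptop.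
  by rewrite chainS // tE // hr.
have xt : admissible x t.
  apply/and4P; split; apply/forallP.
  - by move=> i; rewrite xE muln_gt0 P0 Ei.
  - move=> j; rewrite tE //; have := P0 j.+1; rewrite -hr // expn_gt0.
    by rewrite lt0n => /orP[//|/eqP gj]; have := g_gt0 j.+1 (ltn_ord j); rewrite gj.
  - by move=> k; rewrite !DE // 1?ltnW // Pd.
  - by move=> i; rewrite DE 1?ltnW // xE dvdn_mulr.
apply/imfsetP; exists t; rewrite ?inE //.
apply/ffunP => -[] i; rewrite ffunE !DE ?(ltnW (ltn_ord i)) //.
  by rewrite (PS i) // mulnK // inord_val.
by rewrite xE mulKn.
Qed.

End RamanujanFibers.

(* 1-based indexing as in the paper: f 1 .. f (m+1), g 0 .. g m (gamma_j),
   s 1 .. s (m+1).  A point of N^{m+1} is x : {ffun 'I_(m+1) -> nat}, with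
   n_j = x (j-1).  Conclusion: the multiple series L(s; a_{g 0} S) converges
   absolutely and its sum is the stated product (and the gamma_0 = 1 case). *)
Theorem theorem3p5 (R : realType) (m : nat) (f : nat -> arith R)
  (g : nat -> nat) (s : nat -> R[i]) :
  (0 < m)%N ->
  (forall j, (j <= m)%N -> (0 < g j)%N) ->
  (forall j, (j < m)%N -> (g j %| g j.+1)%N) ->
  (forall j, (2 <= j <= m.+1)%N -> 1 < complex.Re (s j)) ->
  (forall j, (1 <= j <= m.+1)%N ->
     (abscissa (f j) < (complex.Re (\sum_(1 <= i < j.+1) s i))%:E)%E) ->
  let nx := fun (x : {ffun 'I_m.+1 -> nat}) (j : nat) => x (inord j.-1) in
  let sv := fun i : 'I_m.+1 => s i.+1 in
  let F := fun x : {ffun 'I_m.+1 -> nat} =>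
             agam R (g 0%N) (nx x 1%N) * ramS m g f (nx x) in
  [/\ abs_summable (mterm F sv),
      has_sum (mterm F sv)
        ((\prod_(2 <= j < m.+2) zeta (s j)) *
         \prod_(1 <= j < m.+2) Lser (restr (g j.-1) (f j)) (\sum_(1 <= i < j.+1) s i))
    & g 0%N = 1%N ->
      has_sum (mterm (fun x => ramS m g f (nx x)) sv)
        ((\prod_(2 <= j < m.+2) zeta (s j)) * Lser (f 1%N) (s 1%N) *
         \prod_(2 <= j < m.+2) Lser (restr (g j.-1) (f j)) (\sum_(1 <= i < j.+1) s i))].
Proof.
move=> _ g0 gd s2 sf nx sv F.
have absf (j : 'I_m.+1) : abs_summable
    (dterm (restr (g j) (f j.+1)) (\sum_(1 <= l < j.+2) s l)).
  by apply/abs_summable_restr/abs_summable_abscissa/sf; exact: ltn_ord.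
have absz (j : 'I_m.+1) : j != ord0 -> abs_summable (dterm (fun=> 1) (s j.+1)).
  move=> j0; apply/abs_summable_zeta/s2; apply/andP; split; last exact: ltn_ord.
  rewrite ltnS lt0n; apply: contraNneq j0 => j0; exact/eqP/val_inj.
have sum1 : has_sum (fun n : nat => (n == 1%N)%:R : R[i]) 1.
  move=> e e0; exists [fset 1%N]%fset => A; rewrite fsub1set => A1.
  rewrite (big_fsetD1 _ A1) /= big1_seq ?addr0 ?subrr ?normr0 ?(ltcR 0) // => i.
  by rewrite !inE => /andP[_ /andP[/negPf -> _]].
pose Z (u : 'I_m.+1 + 'I_m.+1) : R[i] := match u with
  | inl j => Lser (restr (g j) (f j.+1)) (\sum_(1 <= l < j.+2) s l)
  | inr j => if j == ord0 then 1 else zeta (s j.+1)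
  end.
have absT u : abs_summable (factor R m f g s u).
  case: u => j; first exact: absf.
  rewrite /factor; case: (eqVneq j ord0) => [_|/absz //].
  exists 1 => A; apply: (@le_trans _ _ (\sum_(n <- (A `|` [fset 1%N])%fset) `|(n == 1%N)%:R|)).
    by apply: ler_sum_fset => //; apply: fsubsetUl.
  rewrite (big_fsetD1 1%N) ?inE ?eqxx ?orbT //= normr1 big1_seq ?addr0 // => i.
  by rewrite !inE => /andP[_ /andP[/negPf -> _]]; rewrite normr0.
have sumT u : has_sum (factor R m f g s u) (Z u).
  case: u (absT u) => j; first exact: has_sum_csum.
  by rewrite /factor /Z; case: (eqVneq j ord0) => // _; apply: has_sum_csum.
(* The product family over all parameters is regrouped along [of_params] into the multiple
   series. *)
have [absF sumF] := has_sum_fibers R _ _ (of_params m) (fiber m g) _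
  (mterm F sv) _ (fiber_of_params m g)
  (factor_fiber R m f g s g0 gd) (mterm_fiber R m f g s g0 gd)
  (abs_summable_prod _ _ _ _ absT) (has_sum_prod _ _ _ _ _ absT sumT).
have ZE : \prod_u Z u = (\prod_(2 <= j < m.+2) zeta (s j)) *
    \prod_(1 <= j < m.+2) Lser (restr (g j.-1) (f j)) (\sum_(1 <= i < j.+1) s i).
  rewrite big_sumType [RHS]mulrC; congr (_ * _).
    by rewrite big_add1 big_mkord.
  rewrite big_ord_recl /= mul1r !big_add1 big_mkord.
  exact: eq_bigr.
rewrite ZE in sumF; split=> // g1.
(* Every integer is a first power, so [agam R 1] is constantly 1, both on [n_1] and in the
   restriction of [f 1]. *)
have -> : mterm (fun x => ramS m g f (nx x)) sv = mterm F sv.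
  by apply/funext => x; rewrite /mterm /F g1 /agam is_pow1 mul1r.
rewrite [in X in _ * X * _](_ : f 1%N = restr (g 0%N) (f 1%N)); last first.
  by apply/funext => n; rewrite /restr g1 /agam is_pow1 mul1r.
(* The factor [j = 1] is split off; its exponent is the one-term sum [s 1]. *)
move: sumF; rewrite [X in _ * X]big_ltn // mulrA big_nat1.
by [].
Qed.
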